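(* Let $G=(V,E)$ be a finite strongly connected directed graph (loops and multiple arcs allowed), let $s\in V$ and let $T\subseteq V$ be nonempty such that every arc leaving a vertex of $T$ ends at $s$. Let $m\ge1$. Fix at every vertex $v$ a rotor mechanism with heads $v^1,v^2,\dots$ (periodic with period $d(v)$), and suppose every rotor mechanism is $m$-repetitive: $v^{am+1}=v^{am+2}=\dots=v^{am+m}$ for all $v\in V$ and all integers $a\ge0$. Then the hitting sequence $(t_n)_{n\ge1}$ is $m$-repetitive: $t_{am+1}=t_{am+2}=\dots=t_{am+m}$ for all $a\ge0$.
   Context: $d(v)$ is the out-degree of $v$. A rotor mechanism at $v$ is an ordering $e_v^1,\dots,e_v^{d(v)}$ of the arcs leaving $v$, extended to all $i\in\mathbb{Z}$ periodically with period $d(v)$; $v^i$ is the head of $e_v^i$. The rotor walk from $s$ is the infinite sequence $x_0=s,x_1,\dots$ in which, for every vertex $v$ and $i\ge1$, the $i$-th occurrence of $v$ is immediately followed by $v^i$; the hitting sequence is the subsequence of terms of the rotor walk lying in $T$. *)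

(* Defs.v *)
From mathcomp Require Import all_boot all_order all_algebra.

Set Implicit Arguments.
Unset Strict Implicit.
Unset Printing Implicit Defensive.

(* A finite directed multigraph is given by finite types V and E of vertices  *)
(* and arcs, with the maps tail, head : E -> V; loops and parallel arcs are   *)
(* thus allowed.                                                              *)
Section Digraph.
Variables (V E : finType) (tail head : E -> V).

Definition out_arcs (v : V) : {set E} := [set e | tail e == v].

Definition outdeg (v : V) : nat := #|out_arcs v|.

Definition adj : rel V :=
  [rel u v | [exists e, (tail e == u) && (head e == v)]].

Definition strongly_connected : Prop := forall u v : V, connect adj u v.

(* e 1, ..., e (outdeg v) lists each arc leaving v exactly once.              *)
Definition rotor_mechanism (v : V) (e : int -> E) : Prop :=
  perm_eq [seq e (Posz i) | i <- iota 1 (outdeg v)] (enum (out_arcs v)) /\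
  (forall i : int, e (i + Posz (outdeg v))%R = e i).

Definition rotor_head (rho : V -> int -> E) (v : V) (i : int) : V :=
  head (rho v i).

(* x k is the i-th term (counting from 1) of x_0, x_1, ... that satisfies P.  *)
Definition nth_time (P : pred V) (x : nat -> V) (i k : nat) : Prop :=
  P (x k) /\ count P (mkseq x k.+1) = i.

Definition rotor_walk (rho : V -> int -> E) (s : V) (x : nat -> V) : Prop :=
  x 0 = s /\
  (forall (v : V) (i k : nat), 1 <= i -> nth_time (pred1 v) x i k ->
     x k.+1 = rotor_head rho v (Posz i)).

(* Sequences (t_n)_{n >= 1} are functions on nat whose value at 0 is          *)
(* irrelevant. The predicate forces infinitely many terms of x to lie in T.   *)
Definition hitting_sequence (T : {set V}) (x t : nat -> V) : Prop :=
  forall n : nat, 1 <= n ->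
    exists2 k : nat, nth_time (fun v => v \in T) x n k & t n = x k.

End Digraph.

Definition repetitive (A : Type) (m : nat) (u : nat -> A) : Prop :=
  forall a i j : nat, 1 <= i <= m -> 1 <= j <= m ->
    u (a * m + i) = u (a * m + j).

Section WellDefined.
Variables (V E : finType) (head : E -> V) (rho : V -> int -> E).

Lemma rotor_walk_exists (s : V) : exists x, rotor_walk head rho s x.
Proof.
pose next (h : seq V) := rotor_head head rho (last s h)
                           (Posz (count (pred1 (last s h)) h)).
pose hist n := iter n (fun h => rcons h (next h)) [:: s].
pose x n := last s (hist n).
have histE n : hist n = mkseq x n.+1.
  elim: n => [//|n IHn].
  rewrite (_ : mkseq x n.+2 = rcons (mkseq x n.+1) (x n.+1)).
    by rewrite -IHn /x /= last_rcons.
  by rewrite /mkseq -[in iota _ _]addn1 iotaD map_cat cats1.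
exists x; split=> // v i k _ [/eqP xk <-].
rewrite [LHS]last_rcons /next -histE.
by rewrite (_ : last s (hist k) = v).
Qed.

Lemma rotor_walk_unique (s : V) x y :
  rotor_walk head rho s x -> rotor_walk head rho s y -> x =1 y.
Proof.
move=> [x0 xS] [y0 yS] n; elim/ltn_ind: n => -[|n] IHn; first by rewrite x0 y0.
have eqxy : mkseq x n.+1 = mkseq y n.+1.
  by apply/eq_in_map => k; rewrite mem_iota => /IHn.
have c_gt0 : 0 < count (pred1 (x n)) (mkseq x n.+1).
  by rewrite -has_count has_pred1 map_f // mem_iota /=.
rewrite (xS (x n) _ n c_gt0) //; last by split=> /=.
rewrite (yS (x n) _ n c_gt0) //; split; last by rewrite eqxy.
by rewrite /= IHn.
Qed.

Lemma hitting_sequence_unique (T : {set V}) (x t u : nat -> V) :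
  hitting_sequence T x t -> hitting_sequence T x u ->
  forall n, 1 <= n -> t n = u n.
Proof.
move=> tP uP n n_gt0.
have [k [Tk ck] ->] := tP n n_gt0; have [l [Tl cl] ->] := uP n n_gt0.
wlog lt_kl : k l Tk ck Tl cl / k < l.
  move=> IH; case: (ltngtP k l) => [/IH->//|/IH IH'|->//].
  by apply/esym/IH'.
have: count (fun v => v \in T) (mkseq x l.+1) > n; last by rewrite cl ltnn.
rewrite /mkseq -(subnKC (ltnW lt_kl : k.+1 <= l.+1)) iotaD map_cat count_cat.
rewrite -/(mkseq x k.+1) ck -addn1 leq_add2l -has_count; apply/hasP.
exists (x l) => //; apply: map_f; rewrite mem_iota; apply/andP; split=> //.
by rewrite add0n subnKC // ltnW.
Qed.

End WellDefined.

(* Main.v *)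
Require Import Defs.
From mathcomp Require Import all_boot all_order all_algebra.
From mathcomp Require Import zify.

Set Implicit Arguments.
Unset Strict Implicit.
Unset Printing Implicit Defensive.

(** Let [u v] be the number of visits to [v] before a time at which the number
    of hits in [T] is a multiple of [m] and the walk is back at [s]. Then [u]
    is a fixed point of the inflow operator. Round [u] down to a multiple of
    [m] outside [T], giving [L]: by repetitiveness the inflow produced by [L]
    consists of multiples of [m], and it is at most [u], hence at most [L].
    The walk cannot exceed such an [L] (a first vertex to do so would have been
    entered too often), so [u = L], and the number of hits at each vertex of
    [T] is a multiple of [m]. Thus every block of [m] consecutive hits
    consists of hits at a single vertex. *)

(** * Counting visits and hits along a sequence *)

Section Visits.
Variables (V : finType) (x : nat -> V).

Definition visits (k : nat) (v : V) : nat := count (pred1 v) (mkseq x k).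

Definition hits (T : {set V}) (k : nat) : nat :=
  count (fun v => v \in T) (mkseq x k).

Lemma count_mkseqS (P : pred V) k :
  count P (mkseq x k.+1) = count P (mkseq x k) + P (x k).
Proof. by rewrite /mkseq -addn1 iotaD map_cat count_cat /= addn0. Qed.

Lemma visitsS k v : visits k.+1 v = visits k v + (x k == v).
Proof. exact: count_mkseqS. Qed.

Lemma hitsS T k : hits T k.+1 = hits T k + (x k \in T).
Proof. exact: count_mkseqS. Qed.

Lemma visits_mono v : {homo visits ^~ v : j k / j <= k}.
Proof.
by apply: homo_leq leq_trans _ => [//|k]; rewrite visitsS leq_addr.
Qed.

Lemma hits_mono T : {homo hits T : j k / j <= k}.
Proof. by apply: homo_leq leq_trans _ => [//|k]; rewrite hitsS leq_addr. Qed.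

Lemma hitsE T k : hits T k = \sum_(v in T) visits k v.
Proof.
elim: k => [|k IHk]; first by rewrite big1.
rewrite hitsS IHk; under [RHS]eq_bigr do rewrite visitsS.
rewrite big_split /=; congr (_ + _).
have [xT|xT] := boolP (x k \in T).
  rewrite (bigD1 (x k)) //= eqxx big1 // => v /andP[_].
  by rewrite eq_sym => /negPf->.
by rewrite big1 // => v vT; case: eqP xT => // ->; rewrite vT.
Qed.

Lemma nth_time_hits (T : {set V}) n k :
  nth_time (fun v => v \in T) x n.+1 k <-> x k \in T /\ hits T k = n.
Proof.
by split=> -[xT]; rewrite /nth_time -/(hits T k.+1) hitsS xT addn1;
  [case | move->].
Qed.

Lemma unbounded_hits_hitting_sequence (T : {set V}) :
  (forall k, exists2 l, k <= l & x l \in T) ->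
  exists t, hitting_sequence T x t.
Proof.
move=> Tinf.
have hit_ex n : exists k, (x k \in T) && (hits T k == n).
  elim: n => [|n [k /andP[xk /eqP hk]]].
    have [l _ xl] := Tinf 0; have ex : exists l, x l \in T by exists l.
    have [k xk kmin] := ex_minnP ex; exists k; rewrite xk /= hitsE.
    apply/eqP/big1 => v vT; apply/count_memPn/mapP => -[i].
    rewrite mem_iota add0n => /= ltik vE.
    by move: ltik; rewrite ltnNge kmin // -vE.
  have [l lekl xl] := Tinf k.+1.
  have ex : exists l, (k < l) && (x l \in T) by exists l; rewrite lekl.
  have [j /andP[ltkj xj] jmin] := ex_minnP ex; exists j; rewrite xj /=.
  (* As [j] is the least hit after [k], no term strictly between them adds to the count. *)
  have hS i : k < i -> i <= j -> hits T i = n.+1.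
    elim: i => // i IHi; rewrite ltnS leq_eqVlt => /orP[/eqP <- _|ltki leij].
      by rewrite hitsS xk hk addn1.
    rewrite hitsS IHi ?(ltnW leij) //; case: (boolP (x i \in T)) => [xi|_].
      by move: leij; rewrite ltnNge jmin // ltki.
    by rewrite addn0.
  by rewrite hS.
exists (fun n => x (ex_minn (hit_ex n.-1))) => -[//|n] _ /=.
case: ex_minnP => k /andP[xk /eqP hk] _.
by exists k => //; apply/nth_time_hits.
Qed.

End Visits.

(** * Conservation of flow along a rotor walk *)

Section RotorWalk.
(* [f v i] is the target of the [i]-th exit from [v], counting from 0. *)
Variables (V : finType) (f : V -> nat -> V) (x : nat -> V).
Hypothesis xS : forall k, x k.+1 = f (x k) (visits x k (x k)).

Definition exits (w v : V) (n : nat) : nat :=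
  count (fun i => f w i == v) (iota 0 n).

Definition inflow (A : pred V) (v : V) (c : V -> nat) : nat :=
  \sum_(w | A w) exits w v (c w).

Lemma exitsS w v n : exits w v n.+1 = exits w v n + (f w n == v).
Proof. by rewrite /exits -addn1 iotaD count_cat /= addn0. Qed.

Lemma exits_mono w v : {homo exits w v : i j / i <= j}.
Proof. by apply: homo_leq leq_trans _ => [//|n]; rewrite exitsS leq_addr. Qed.

Lemma inflow_mono A v c d :
  (forall w, c w <= d w) -> inflow A v c <= inflow A v d.
Proof. by move=> lecd; apply: leq_sum => w _; apply: exits_mono. Qed.

(** Each term other than the starting one is entered by exactly one exit, and the exits made by the
    first [k] terms lead to terms 1 to [k]. *)
Lemma visits_inflow k v :
  visits x k.+1 v = (x 0 == v) + inflow xpredT v (visits x k).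
Proof.
elim: k => [|k IHk].
  by rewrite visitsS /inflow big1 ?addn0.
rewrite visitsS IHk -addnA; congr (_ + _).
rewrite /inflow [LHS]addnC (bigD1 (x k)) //= [RHS](bigD1 (x k)) //=.
rewrite visitsS eqxx addn1 exitsS -xS addnA [_ + exits _ _ _]addnC.
congr (_ + _); apply: eq_bigr => w.
by rewrite visitsS eq_sym => /negPf->; rewrite addn0.
Qed.

(** * Divisibility of visit counts by [m] *)

Section Repetitive.
Variables (s : V) (T : {set V}) (m : nat).
Hypothesis m_gt0 : 0 < m.
Hypothesis x0 : x 0 = s.
Hypothesis fT : forall v i, v \in T -> f v i = s.
Hypothesis frep : forall v a i, i < m -> f v (a * m + i) = f v (a * m).

Lemma dvdn_exits w v n : m %| n -> m %| exits w v n.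
Proof.
case/dvdnP=> q ->; elim: q => [|q IHq]; first by rewrite mul0n dvdn0.
rewrite mulSn addnC /exits iotaD count_cat dvdn_addr //.
rewrite add0n -[q * m]addn0 iotaDl count_map.
rewrite (eq_in_count (a2 := fun=> f w (q * m) == v)) => [|i]; last first.
  by rewrite mem_iota => /= ltim; rewrite frep.
by case: (_ == v); rewrite ?count_predT ?size_iota ?count_pred0 ?dvdn0.
Qed.

(** Every exit from [T] leads to [s], so [T] feeds only [s], whatever the distribution of the
    hits. *)
Lemma inflow_split v c :
  inflow xpredT v c =
  (s == v) * (\sum_(w in T) c w) + inflow [predC T] v c.
Proof.
rewrite /inflow (bigID (mem T)) /=; congr (_ + _).
rewrite big_distrr; apply: eq_bigr => w wT /=.
elim: (c w) => [|n IHn]; first by rewrite muln0.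
by rewrite exitsS IHn fT // -mulnSr.
Qed.

Lemma dvdn_visits_hit k : x k \in T -> m %| hits x T k.+1 ->
  forall v, v \in T -> m %| visits x k.+1 v.
Proof.
move=> xkT dvdH v vT; set u := visits x k.+1.
(* Since [x k] lies in [T], the term at time [k.+1] is [s]; this visit cancels the starting one. *)
have u_fix w : u w = inflow xpredT w u.
  have := visits_inflow k.+1 w; rewrite visitsS -/u x0 xS fT //; lia.
pose L w := if w \in T then u w else u w %/ m * m.
have leLu w : L w <= u w by rewrite /L; case: ifP; rewrite ?leq_trunc_div.
have inflowL w : inflow xpredT w L =
    (s == w) * hits x T k.+1 + inflow [predC T] w L.
  rewrite inflow_split hitsE; congr (_ * _ + _).
  by apply: eq_bigr => z zT; rewrite /L zT.
have dvdL w : m %| inflow xpredT w L.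
  rewrite inflowL dvdn_addr ?dvdn_mull //; apply: dvdn_sum => z /negPf zT.
  by apply: dvdn_exits; rewrite /L zT dvdn_mull.
have leL w : inflow xpredT w L <= L w.
  have le_u : inflow xpredT w L <= u w by rewrite [u w]u_fix inflow_mono.
  rewrite {2}/L; case: ifP => // _.
  by case/dvdnP: (dvdL w) le_u => q ->; rewrite leq_mul2r leq_divRL // => ->;
    rewrite orbT.
(* In the induction step fewer hits have occurred than by time [k.+1], as the hit at time [k] is not
   yet counted; that spare hit pays for the starting visit to [s]. *)
have le_visits j : j <= k.+1 -> forall w, visits x j w <= L w.
  elim: j => [//|j IHj] lejk w; have {IHj} IHj := IHj (ltnW lejk).
  case: (boolP (w \in T)) => [wT|_]; first by rewrite /L wT visits_mono.
  apply: leq_trans (leL w); rewrite visits_inflow inflowL inflow_split -hitsE.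
  rewrite x0 addnA leq_add ?inflow_mono // -mulnS leq_mul2l.
  by rewrite hitsS xkT addn1 ltnS hits_mono ?orbT.
have uL w : u w = L w by apply/eqP; rewrite eqn_leq leLu le_visits.
suff <- : inflow xpredT v L = u v by [].
by rewrite [RHS]u_fix; apply: eq_bigr => w _; rewrite uL.
Qed.

(** Terms outside [T] change none of these counts, so one may go back to the time just after the
    last hit. *)
Lemma dvdn_visits k : m %| hits x T k ->
  forall v, v \in T -> m %| visits x k v.
Proof.
elim: k => [//|k IHk] dvdH v vT.
have [xkT|xkT] := boolP (x k \in T); first exact: dvdn_visits_hit.
rewrite visitsS; case: eqP => [xkv|_]; first by rewrite xkv vT in xkT.
by rewrite addn0 IHk //; move: dvdH; rewrite hitsS (negPf xkT) addn0.
Qed.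

(** Exactly [m] hits occur from [j] up to [l], while each vertex of [T] hit there accounts for a
    positive multiple of [m] of them; two distinct vertices would need [2m]. *)
Lemma hit_block_constant a j k l :
    x j \in T -> hits x T j = a * m ->
    x k \in T -> j <= k < l -> hits x T l = a.+1 * m ->
  x k = x j.
Proof.
move=> xj hj xk /andP[lejk ltkl] hl; apply/eqP/negPn/negP => neq.
have lejl : j <= l by lia.
have grow i : j <= i < l -> x i \in T ->
    visits x j (x i) + m <= visits x l (x i).
  case/andP=> leji ltil xi.
  have lt : visits x j (x i) < visits x l (x i).
    apply: leq_trans (visits_mono x (x i) ltil).
    by rewrite visitsS eqxx addn1 ltnS visits_mono.
  have : m %| visits x l (x i) - visits x j (x i).
    by rewrite dvdn_sub // dvdn_visits // ?hl ?hj dvdn_mull.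
  by move/dvdn_leq; lia.
have := hl; rewrite mulSn -hj !hitsE.
rewrite (bigD1 (x j)) // (bigD1 (x k)) ?xk //=.
rewrite [in RHS](bigD1 (x j)) // [in RHS](bigD1 (x k)) ?xk //=.
have := grow j; rewrite leqnn (leq_ltn_trans lejk ltkl) => /(_ isT xj).
have := grow k; rewrite lejk ltkl => /(_ isT xk).
set A := \sum_(_ | _) _; set B := \sum_(_ | _) _.
have : B <= A by apply: leq_sum => w _; apply: visits_mono.
lia.
Qed.

Lemma hitting_sequence_repetitive t : hitting_sequence T x t -> repetitive m t.
Proof.
move=> ht a.
suff first i : 1 <= i <= m -> t (a * m + i) = t (a * m).+1.
  by move=> i j hi hj; rewrite !first.
case: i => [//|i] ltim.
have [j /nth_time_hits[xj hj] ->] := ht (a * m).+1 isT.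
have [k + ->] := ht (a * m + i.+1) ltac:(lia).
rewrite addnS => /nth_time_hits[xk hk].
(* The last hit of the block is at time [l], so the count first reaches [a.+1 * m] at [l.+1]. *)
have [l + _] := ht (a * m + m) ltac:(lia).
case=> xl; rewrite -/(hits x T l.+1) addnC -mulSn => hl.
apply: (@hit_block_constant a j k l.+1) => //; apply/andP; split.
  rewrite leqNgt; apply/negP => /(@hits_mono _ x T k.+1 j).
  by rewrite hitsS xk hk hj; lia.
rewrite ltnNge; apply/negP => /(@hits_mono _ x T l.+1 k).
by rewrite hl hk; lia.
Qed.

End Repetitive.

(** * Every vertex is visited infinitely often *)

Section Recurrence.
Variable e : rel V.
Hypothesis f_hits : forall u v, e u v ->
  forall n, exists2 i, n <= i & f u i = v.

Lemma exits_unbounded u v : e u v -> forall n, exists b, n <= exits u v b.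
Proof.
move=> euv; elim=> [|n [b leb]]; first by exists 0.
have [i lebi fi] := f_hits euv b; exists i.+1.
by rewrite exitsS fi eqxx addn1 ltnS (leq_trans leb) // exits_mono.
Qed.

(* The bound [b] is uniform in the time [k], which allows the starting vertex
   of [visits_unbounded] to be chosen by pigeonhole at a single time. *)
Lemma visits_connect u v : connect e u v ->
  forall n, exists b, forall k, b <= visits x k u ->
  exists l, n <= visits x l v.
Proof.
case/connectP=> p; elim: p u => [|w p IHp] u /=.
  by move=> _ -> n; exists n => k; exists k.
case/andP=> euw pp lp n; have [c cP] := IHp _ pp lp n.
have [b leb] := exits_unbounded euw c; exists b => k lebk.
apply: (cP k.+1); rewrite visits_inflow /inflow (bigD1 u) //=.
have := exits_mono u w lebk; lia.
Qed.

Lemma sum_visits k : \sum_v visits x k v = k.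
Proof.
elim: k => [|k IHk]; first by rewrite big1.
under eq_bigr do rewrite visitsS.
rewrite big_split /= IHk (bigD1 (x k)) //= eqxx big1 ?addn0 ?addn1 // => v.
by rewrite eq_sym => /negPf->.
Qed.

Lemma visits_unbounded v : (forall u, connect e u v) ->
  forall n, exists l, n <= visits x l v.
Proof.
move=> econn n.
have [b bP] := fin_all_exists (fun u => visits_connect (econn u) n).
pose B := \max_u b u.
(* All visits together number [#|V| * B + 1], too many for every vertex to stay below [B]. *)
have [u] : exists u, B <= visits x (#|V| * B).+1 u.
  have [/existsP//|/existsPn ltB] :=
    boolP [exists u, B <= visits x (#|V| * B).+1 u].
  suff : (#|V| * B).+1 <= #|V| * B by rewrite ltnn.
  rewrite -[leqLHS]sum_visits -[leqRHS]sum_nat_const.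
  apply: leq_sum => u _.
  by have := ltB u; rewrite -ltnNge => /ltnW.
by move=> leB; apply: bP (leq_trans _ leB); apply: leq_bigmax.
Qed.

Lemma visits_unbounded_after v : (forall u, connect e u v) ->
  forall k, exists2 l, k <= l & x l = v.
Proof.
move=> econn k; have [l] := visits_unbounded econn (visits x k v).+1.
elim: l => [//|l IHl]; rewrite visitsS; case: eqP => [xl|_]; last first.
  by rewrite addn0.
case: (leqP k l) => [lekl _|/(@visits_mono _ x v l.+1 k)]; first by exists l.
by rewrite visitsS xl eqxx; lia.
Qed.

End Recurrence.

End RotorWalk.

(** * Rotor mechanisms and the final assembly *)

Section Mechanism.
Variables (V E : finType) (tail head : E -> V) (v : V) (e : int -> E).
Hypothesis he : rotor_mechanism tail v e.

Lemma rotor_mechanism_period (i q : nat) :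
  e (Posz (i + q * outdeg tail v)) = e (Posz i).
Proof.
elim: q => [|q IHq]; first by rewrite addn0.
by rewrite mulSn addnCA addnC PoszD he.2.
Qed.

Lemma rotor_mechanism_tail (i : nat) :
  0 < outdeg tail v -> tail (e (Posz i.+1)) = v.
Proof.
set d := outdeg tail v => d_gt0.
(* Periodicity brings the index into the range from 1 to [d], where the arcs are listed. *)
rewrite (divn_eq i d) -addn1 -addnA addnC rotor_mechanism_period addn1.
suff : e (Posz (i %% d).+1) \in enum (out_arcs tail v).
  by rewrite mem_enum inE => /eqP.
rewrite -(perm_mem he.1); apply: map_f.
by rewrite mem_iota add1n /= ltnS ltn_mod.
Qed.

Lemma rotor_mechanism_hits w : adj tail head v w ->
  forall n, exists2 i, n <= i & head (e (Posz i.+1)) = w.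
Proof.
case/existsP=> a /andP[av /eqP <-] n.
have : a \in enum (out_arcs tail v) by rewrite mem_enum inE.
rewrite -(perm_mem he.1) => /mapP[[|i]]; rewrite mem_iota // => ltid ->.
exists (i + n * outdeg tail v); first by nia.
by rewrite -addSn rotor_mechanism_period.
Qed.

End Mechanism.

(** A path from [v] to the tail of [a] is either empty, so that [a] leaves [v], or begins with an
    arc leaving [v]. The arc [a] excludes a single vertex without arcs. *)
Lemma strongly_connected_outdeg (V E : finType) (tail head : E -> V) (a : E) :
  strongly_connected tail head -> forall v, 0 < outdeg tail v.
Proof.
move=> sc v; apply/card_gt0P.
have [<-|neq] := eqVneq (tail a) v; first by exists a; rewrite inE.
case/connectP: (sc v (tail a)) => -[|w p] /=.
  by move=> _ eqv; rewrite eqv eqxx in neq.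
by case/andP=> /existsP[b /andP[bv _]] _ _; exists b; rewrite inE.
Qed.

Theorem theorem4 (V E : finType) (tail head : E -> V)
    (hG : strongly_connected tail head)
    (s : V) (T : {set V}) (hT0 : T != set0)
    (hTs : forall e : E, tail e \in T -> head e = s)
    (m : nat) (hm : 1 <= m)
    (rho : V -> int -> E)
    (hrho : forall v : V, rotor_mechanism tail v (rho v))
    (hrep : forall v : V, repetitive m (fun i : nat => rotor_head head rho v (Posz i)))
    (x : nat -> V) (hx : rotor_walk head rho s x) :
  exists t : nat -> V, hitting_sequence T x t /\ repetitive m t.
Proof.
case: hx => x0 xS.
pose f v i := rotor_head head rho v (Posz i.+1).
have xf k : x k.+1 = f (x k) (visits x k (x k)).
  apply: xS => //; split; first exact: eqxx.
  by rewrite -/(visits x k.+1 (x k)) visitsS eqxx addn1.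
have fT v i : v \in T -> f v i = s.
  move=> vT; apply: hTs; rewrite (rotor_mechanism_tail (hrho v)) //.
  (* The value [rho v 0] serves only as a witness that some arc exists. *)
  exact: strongly_connected_outdeg (rho v 0%R) hG v.
have frep v a i : i < m -> f v (a * m + i) = f v (a * m).
  move=> ltim; have := hrep v a i.+1 1.
  by rewrite addnS addn1; apply; rewrite ?ltim.
have f_hits u v := @rotor_mechanism_hits V E tail head u (rho u) (hrho u) v.
have [v vT] := set0Pn _ hT0.
have [k|t ht] := @unbounded_hits_hitting_sequence V x T.
  have [l lekl xl] := visits_unbounded_after xf f_hits (hG ^~ v) k.
  by exists l; rewrite ?xl.
exists t; split=> //.
exact: (hitting_sequence_repetitive xf hm x0 fT frep).
Qed.
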